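(* If $X$ is a random variable (taking values in $\mathbb{R}$) with at least two point masses, then $(X,\cos(x))$ is not reasonable. Moreover, if $X$ is a random vector in $\mathbb{R}^n$ with at least two point masses, then, for some $j\in\{1,\dots,n\}$, $(X,\cos(\pi_j(x)))$ is not reasonable, where $\pi_j:\mathbb{R}^n\to\mathbb{R}$ is the projection onto the $j$th coordinate.
   Context: A dart is a random vector $X$ taking values in $\mathbb{R}^n$. A payoff function is a measurable function $f:\mathbb{R}^n\to\mathbb{R}$ bounded from above. For $d>0$, $g_{X,f}(d):=\sup_{a\in\mathbb{R}^n}Ef(a+dX)$. The pair $(X,f)$ is reasonable if $g_{X,f}(d)$ is decreasing (i.e. non-increasing) in $d\in(0,\infty)$. A point mass of $X$ is a point $x$ with $P(X=x)>0$. There may additionally be a part of the distribution without point masses. *)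

(* Defs.v *)
From HB Require Import structures.
From mathcomp Require Import all_boot all_order all_algebra.
From mathcomp Require Import all_classical all_reals all_analysis.
From mathcomp Require Import measurable_realfun.

Set Implicit Arguments.
Unset Strict Implicit.
Unset Printing Implicit Defensive.

Import Order.TTheory GRing.Theory Num.Theory.
Import numFieldNormedType.Exports.

Local Open Scope classical_set_scope.
Local Open Scope ring_scope.

Definition borel (V : ptopologicalType) := g_sigma_algebraType (@open V).

Definition payoff (R : realType) d (V : measurableType d) (f : V -> R) :=
  measurable_fun [set: V] f /\ has_ubound (range f).

(* [V] is [R^o] for darts on the real line and ['rV[R]_n] for darts in R^n.
   The expectation is extended-real because a payoff is only bounded from
   above.  Measurability of [X] and [payoff f] are not built into
   [best_payoff] and [reasonable]; for the cosine payoffs see [payoff_cos] and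
   [payoff_cos_proj]. *)
Definition best_payoff (R : realType) d (T : measurableType d)
    (P : probability T R) (V : lmodType R) (X : T -> V) (f : V -> R) (s : R)
  : \bar R :=
  ereal_sup [set 'E_P[fun w => (f (a + s *: X w))%R]%E | a in [set: V]].

Definition reasonable (R : realType) d (T : measurableType d)
    (P : probability T R) (V : lmodType R) (X : T -> V) (f : V -> R) :=
  forall s t : R, 0 < s -> s <= t ->
    (best_payoff P X f t <= best_payoff P X f s)%E.

Definition point_mass (R : realType) d (T : measurableType d)
    (P : probability T R) (V : Type) (X : T -> V) (x : V) :=
  (0 < P [set w | X w = x])%E.

Definition two_point_masses (R : realType) d (T : measurableType d)
    (P : probability T R) (V : Type) (X : T -> V) :=
  exists x y : V, [/\ x <> y, point_mass P X x & point_mass P X y].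

Definition coord_proj (R : realType) n (j : 'I_n) (x : 'rV[R]_n) : R :=
  x ord0 j.

Lemma has_ubound_cos (R : realType) (U : Type) (h : U -> R) :
  has_ubound (range (cos \o h)).
Proof. by exists 1 => _ [x _ <-]; exact: cos_le1. Qed.

Lemma payoff_cos (R : realType) : payoff (@cos R).
Proof.
split; last exact: (@has_ubound_cos _ _ id).
exact: (continuous_measurable_fun (@continuous_cos R)).
Qed.

Lemma payoff_cos_proj (R : realType) n (j : 'I_n) :
  @payoff R _ (borel 'rV[R]_n) (cos \o coord_proj j).
Proof.
split; last exact: has_ubound_cos.
apply: (measurability _ (RGenOpens.measurableE R)) => _ [_ [a [b ->]] <-].
rewrite setTI; apply: sub_sigma_algebra => /=.
apply: open_comp => [x _|]; last exact: interval_open.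
apply: continuous_comp; last exact: continuous_cos.
exact: coord_continuous.
Qed.

(* Main.v *)
Require Import Defs.
From HB Require Import structures.
From mathcomp Require Import all_boot all_order all_algebra.
From mathcomp Require Import all_classical all_reals all_analysis.
From mathcomp Require Import measurable_realfun ring lra.
Set Implicit Arguments.
Unset Strict Implicit.
Unset Printing Implicit Defensive.

Import Order.TTheory GRing.Theory Num.Theory.
Import numFieldNormedType.Exports.
Local Open Scope classical_set_scope.
Local Open Scope ring_scope.

(** For a real random variable X with characteristic function phi, the best
    payoff of cos at scale s is g(s) = |phi(s)|: the expectation of
    cos(a + s X) is cos(a) E cos(sX) - sin(a) E sin(sX), and the best shift a
    rotates this to the length of the vector (E cos(sX), E sin(sX)); see
    [best_payoff_cos].  So reasonableness says that |phi|^2 is non-increasing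
    on the positive half-line.

    Suppose X has atoms x < y, of masses p and q.  Put delta = pi / (y - x) and
    test |phi|^2 at the points k delta.  On the one hand the alternating sums
    1 + 2 sum_(1 <= k <= n) (-1)^k |phi(k delta)|^2 are at most 1, because
    |phi|^2 is nonnegative and non-increasing ([alternating_sum_le1]).
    On the other hand |phi(s)|^2 is E cos(s (X - X')) with X' an independent
    copy of X, so adding these sums over n < N gives the expectation of a
    kernel evaluated at delta (X - X').  That kernel is the Fejer kernel
    translated by pi: it is nonnegative, and at delta (y - x) = pi it is N^2.
    Hence N^2 p q <= N for every N, which is absurd.

    The independent copy X' enters through an iterated expectation: the
    expectation over X is taken with X' frozen at a real number z
    ([correlation]); it is a trigonometric polynomial in z, into which X is then
    substituted ([Ex_correlation]).

    In dimension n two distinct atoms differ in some coordinate j.  The jth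
    coordinate of X is then a real random variable with two atoms, and it has
    the same best payoffs for cos as X has for cos composed with the jth
    projection. *)

(** * The Fejer kernel translated by pi *)

Section AlternatingFejer.
Variable R : realType.
Implicit Types (u v th : R) (h : nat -> R).

(** The two-sided sum of (-1)^k h(|k|) over -n <= k <= n, folded under the
    normalization h 0 = 1 that holds both for cosines and for |phi|^2. *)
Definition alternating_sum h n : R :=
  1 + 2 * \sum_(k < n) (-1) ^+ k.+1 * h k.+1.

(** The Dirichlet kernel at th + pi. *)
Definition alternating_dirichlet n th : R :=
  alternating_sum (fun k => cos (k%:R * th)) n.

(** The terms pair up as - h (2m+1) + h (2m+2) <= 0, and an unpaired last term
    has odd index, hence a negative sign. *)
Lemma alternating_sum_le1 h n :
  (forall k, 0 <= h k.+1) -> (forall k, h k.+2 <= h k.+1) ->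
  alternating_sum h n <= 1.
Proof.
move=> h0 hdec.
have even m : \sum_(k < m.*2) (-1) ^+ k.+1 * h k.+1 <= 0.
  elim: m => [|m IHm]; first by rewrite big_ord0.
  rewrite doubleS !big_ord_recr/= !exprS -signr_odd odd_double/=.
  by have := hdec m.*2; lra.
rewrite /alternating_sum -[n]odd_double_half addnC.
have {even} := even n./2.
case: (odd n); rewrite ?addn0 ?addn1; last by lra.
rewrite big_ord_recr/= exprS -signr_odd odd_double/=.
by have := h0 n./2.*2; lra.
Qed.

(** Nonnegativity is not visible on the Dirichlet kernels, but their sum is the
    squared modulus of sum_(j < N) (-1)^j e^(i j th). *)
Lemma alternating_fejerE N th :
  \sum_(n < N) alternating_dirichlet n th =
  (\sum_(j < N) (-1) ^+ j * cos (j%:R * th)) ^+ 2 +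
  (\sum_(j < N) (-1) ^+ j * sin (j%:R * th)) ^+ 2.
Proof.
elim: N => [|N IHN]; first by rewrite !big_ord0; ring.
rewrite !big_ord_recr/= {}IHN.
set A := \sum_(j < N) _ * cos _; set B := \sum_(j < N) _ * sin _.
have -> : alternating_dirichlet N th =
    1 + 2 * ((-1) ^+ N * (A * cos (N%:R * th) + B * sin (N%:R * th))).
  rewrite /alternating_dirichlet /alternating_sum; congr (1 + 2 * _).
  rewrite !mulr_suml -big_split/= mulr_sumr.
  (* Expanding (A + iB) against e^(i N th) gives the frequencies N - j. *)
  rewrite (reindex_inj rev_ord_inj)/=; apply: eq_bigr => j _.
  rewrite subnSK// natrB ?(ltnW (ltn_ord j))// mulrBl cosB.
  rewrite -[in (-1) ^+ N](subnK (ltnW (ltn_ord j))) exprD.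
  have : (-1) ^+ j * (-1) ^+ j = 1 :> R by rewrite -expr2 sqrr_sign.
  move: ((-1) ^+ j) => s ss.
  move: ((-1) ^+ _) => s';   ring: ss.
have ss : (-1) ^+ N * (-1) ^+ N = 1 :> R by rewrite -expr2 sqrr_sign.
have cs := cos2Dsin2 (N%:R * th).
move: (cos (N%:R * th)) (sin (N%:R * th)) ((-1) ^+ N : R) ss cs => c b s ss cs.
have -> : (A + s * c) ^+ 2 + (B + s * b) ^+ 2 =
    A ^+ 2 + B ^+ 2 + (s * s * (c ^+ 2 + b ^+ 2) + 2 * (s * (A * c + B * b))).
  by ring.
by rewrite ss cs mul1r.
Qed.

Lemma alternating_fejer_ge0 N th :
  0 <= \sum_(n < N) alternating_dirichlet n th.
Proof. by rewrite alternating_fejerE addr_ge0// sqr_ge0. Qed.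

Lemma cos_natmul_pi j : cos (j%:R * pi) = (-1) ^+ j :> R.
Proof.
elim: j => [|j IHj]; first by rewrite mul0r cos0.
by rewrite -natr1 mulrDl mul1r cosDpi IHj exprS mulN1r.
Qed.

Lemma alternating_fejer_pi N :
  N%:R ^+ 2 <= \sum_(n < N) alternating_dirichlet n (pi : R).
Proof.
rewrite alternating_fejerE.
rewrite [X in X ^+ 2 + _](_ : _ = N%:R) ?lerDl ?sqr_ge0//.
under eq_bigr => j _ do rewrite cos_natmul_pi -expr2 sqrr_sign.
by rewrite sumr_const card_ord.
Qed.

Lemma unit_circle_angle u v :
  u ^+ 2 + v ^+ 2 = 1 -> exists a, cos a = u /\ sin a = v.
Proof.
move=> uv1.
have u1 : -1 <= u <= 1.
  by rewrite -ler_norml -[leRHS]normr1 -ler_sqr ?nnegrE// !real_normK ?num_real//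
    expr1n -uv1 lerDl sqr_ge0.
have sin_acosE : sin (acos u) = `|v|.
  by rewrite sin_acos// -uv1 (addrC (u ^+ 2)) addrK sqrtr_sqr.
have [v0|v0] := leP 0 v.
  by exists (acos u); rewrite acosK ?in_itv// sin_acosE ger0_norm.
by exists (- acos u);
  rewrite cosN sinN acosK ?in_itv// sin_acosE ltr0_norm// opprK.
Qed.

(** The maximum of Re (e^(ib) (u + iv)) over b is the modulus of u + iv. *)
Lemma max_cos_combination u v :
  exists2 a, cos a * u - sin a * v = Num.sqrt (u ^+ 2 + v ^+ 2) &
    forall b, cos b * u - sin b * v <= Num.sqrt (u ^+ 2 + v ^+ 2).
Proof.
set r := Num.sqrt _.
have r2 : r ^+ 2 = u ^+ 2 + v ^+ 2 by rewrite sqr_sqrtr// addr_ge0// sqr_ge0.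
have ub b : cos b * u - sin b * v <= r.
  apply: le_trans (ler_norm _) _; rewrite -sqrtr_sqr ler_wsqrtr//.
  rewrite -[leRHS]mul1r -(cos2Dsin2 b) -subr_ge0.
  (* Cauchy-Schwarz, with Lagrange's identity for the defect. *)
  rewrite (_ : _ - _ = (cos b * v + sin b * u) ^+ 2) ?sqr_ge0//; ring.
have [r0|r0] := eqVneq r 0.
  move: r2; rewrite r0 expr0n/= => /esym/eqP.
  rewrite paddr_eq0 ?sqr_ge0// !sqrf_eq0 => /andP[/eqP u0 /eqP v0].
  by exists 0; rewrite ?u0 ?v0 ?mulr0 ?subrr// => b; rewrite -u0 -v0; exact: ub.
have [|a [ca sa]] := @unit_circle_angle (u / r) (- v / r).
  by rewrite !expr_div_n sqrrN -mulrDl -r2 divff// sqrf_eq0.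
exists a => //; rewrite ca sa.
transitivity (r ^+ 2 / r); first by rewrite r2; field.
by rewrite expr2 mulfK.
Qed.

End AlternatingFejer.

(** * Real-valued expectations *)

Section RealExpectation.
Variables (R : realType) (d : measure_display) (T : measurableType d).
Variable P : probability T R.
Implicit Types f g : T -> R.

Local Notation Ex f := (Rintegral P setT f).
Local Notation L1 f := (P.-integrable setT (EFin \o f)).

Lemma bounded_L1 f M : measurable_fun setT f -> (forall w, `|f w| <= M) -> L1 f.
Proof.
move=> mf fM; apply: measurable_bounded_integrable => //.
  exact: fin_num_fun_lty (fin_num_measure P).
exists M; split; rewrite ?num_real// => N MN w _.
exact: le_trans (fM w) (ltW MN).
Qed.

Lemma L1_cst c : L1 (fun=> c).
Proof. exact: finite_measure_integrable_cst. Qed.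

Lemma L1_D f g : L1 f -> L1 g -> L1 (fun w => f w + g w).
Proof. by move=> If Ig; exact: (integrableD measurableT If Ig). Qed.

Lemma L1_Zl c f : L1 f -> L1 (fun w => c * f w).
Proof. by move=> If; exact: (integrableZl measurableT c If). Qed.

Lemma L1_sum n (f : nat -> T -> R) :
  (forall k, L1 (f k)) -> L1 (fun w => \sum_(k < n) f k w).
Proof.
move=> If; elim: n => [|n IHn].
  by under eq_fun do rewrite big_ord0; exact: L1_cst.
by under eq_fun do rewrite big_ord_recr; exact: L1_D.
Qed.

Lemma Ex_cst c : Ex (fun=> c) = c.
Proof. by rewrite -[RHS]/(fine c%:E) -(expectation_cst P) unlock. Qed.

Lemma Ex_sum n (f : nat -> T -> R) : (forall k, L1 (f k)) ->
  Ex (fun w => \sum_(k < n) f k w) = \sum_(k < n) Ex (f k).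
Proof.
move=> If; elim: n => [|n IHn].
  by under eq_Rintegral do rewrite big_ord0; rewrite Ex_cst big_ord0.
under eq_Rintegral do rewrite big_ord_recr.
by rewrite RintegralD//= ?IHn ?big_ord_recr//; exact: L1_sum.
Qed.

Lemma L1_alternating_sum n (f : nat -> T -> R) : (forall k, L1 (f k)) ->
  L1 (fun w => alternating_sum (f ^~ w) n).
Proof.
move=> If; apply: L1_D; first exact: L1_cst.
apply: L1_Zl; apply: (@L1_sum n (fun k w => (-1) ^+ k.+1 * f k.+1 w)) => k.
exact: L1_Zl.
Qed.

Lemma Ex_alternating_sum n (f : nat -> T -> R) : (forall k, L1 (f k)) ->
  Ex (fun w => alternating_sum (f ^~ w) n) =
  alternating_sum (fun k => Ex (f k)) n.
Proof.
move=> If.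
have If' k : L1 (fun w => (-1) ^+ k.+1 * f k.+1 w) by exact: L1_Zl.
have IS := L1_sum n If'.
rewrite RintegralD//; [|exact: L1_cst|exact: L1_Zl].
rewrite Ex_cst RintegralZl// (Ex_sum n If'); congr (1 + 2 * _).
by apply: eq_bigr => k _; rewrite RintegralZl.
Qed.

(** Markov's inequality, on an arbitrary event; it extracts the contribution of
    an atom. *)
Lemma Ex_ge_on_event f c (A : set T) : measurable A -> L1 f ->
  (forall w, 0 <= f w) -> (forall w, A w -> c <= f w) -> c * fine (P A) <= Ex f.
Proof.
move=> mA If f0 fc; rewrite -Rintegral_cst// [leLHS]Rintegral_mkcond.
have IA : L1 ((fun=> c) \_ A).
  apply: (@bounded_L1 _ `|c|).
    by apply/(measurable_restrictT _ mA).1; exact: measurable_cst.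
  by move=> w; rewrite patchE; case: ifP => //; rewrite normr0.
apply: le_Rintegral => // w _.
by rewrite patchE; case: ifPn => // /set_mem; exact: fc.
Qed.

End RealExpectation.

(** * The characteristic function on the real line *)

Section CharacteristicFunction.
Variables (R : realType) (d : measure_display) (T : measurableType d).
Variables (P : probability T R) (X : T -> R).
Hypothesis mX : measurable_fun setT X.

Local Notation Ex f := (Rintegral P setT f).
Local Notation L1 f := (P.-integrable setT (EFin \o f)).

(** The real and imaginary parts of the characteristic function of X. *)
Definition cos_transform (s : R) : R := Ex (fun w => cos (s * X w)).
Definition sin_transform (s : R) : R := Ex (fun w => sin (s * X w)).
Definition sqnorm_charfun (s : R) : R :=
  cos_transform s ^+ 2 + sin_transform s ^+ 2.

Lemma L1_cos s : L1 (fun w => cos (s * X w)).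
Proof.
apply: (@bounded_L1 _ _ _ _ _ 1) => [|w]; last
  by rewrite ler_norml cos_geN1 cos_le1.
apply: measurableT_comp; last exact: measurable_funM.
exact: (continuous_measurable_fun (@continuous_cos R)).
Qed.

Lemma L1_sin s : L1 (fun w => sin (s * X w)).
Proof.
apply: (@bounded_L1 _ _ _ _ _ 1) => [|w]; last
  by rewrite ler_norml sin_geN1 sin_le1.
apply: measurableT_comp; last exact: measurable_funM.
exact: (continuous_measurable_fun (@continuous_sin R)).
Qed.

Lemma Ex_cos_shift a s : Ex (fun w => cos (a + s * X w)) =
  cos a * cos_transform s - sin a * sin_transform s.
Proof.
under eq_Rintegral do rewrite cosD.
rewrite RintegralB//; try by apply: L1_Zl; [exact: L1_cos || exact: L1_sin].
by rewrite !RintegralZl//; [exact: L1_sin|exact: L1_cos].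
Qed.

Lemma L1_cos_shift a s : L1 (fun w => cos (a + s * X w)).
Proof.
apply: (@bounded_L1 _ _ _ _ _ 1) => [|w]; last
  by rewrite ler_norml cos_geN1 cos_le1.
apply: measurableT_comp; last first.
  by apply: measurable_funD => //; exact: measurable_funM.
exact: (continuous_measurable_fun (@continuous_cos R)).
Qed.

Lemma best_payoff_cos s :
  best_payoff P (X : T -> R^o) cos s = (Num.sqrt (sqnorm_charfun s))%:E.
Proof.
have ExE a : 'E_P[fun w => cos (a + s *: (X w : R^o))]%E =
    (cos a * cos_transform s - sin a * sin_transform s)%:E.
  rewrite -Ex_cos_shift /Rintegral fineK ?expectation.unlock//.
  by apply: integrable_fin_num => //; exact: L1_cos_shift.
have [a amax ub] := max_cos_combination (cos_transform s) (sin_transform s).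
apply/eqP; rewrite eq_le; apply/andP; split.
  by apply: ge_ereal_sup => _ [b _ <-]; rewrite ExE lee_fin ub.
by apply: ereal_sup_ubound; exists a => //; rewrite ExE amax.
Qed.

Lemma reasonable_cos_sqnorm : reasonable P (X : T -> R^o) cos ->
  forall s t, 0 < s -> s <= t -> sqnorm_charfun t <= sqnorm_charfun s.
Proof.
move=> rX s t s0 st; have := rX s t s0 st.
rewrite !best_payoff_cos lee_fin ler_sqrt// /sqnorm_charfun.
by rewrite addr_ge0// sqr_ge0.
Qed.

Lemma L1_dilated_cos dl z k :
  L1 (fun w => cos (k%:R * (dl * (X w - z)))).
Proof.
rewrite (_ : (fun w => _) = fun w => cos (- (k%:R * dl * z) + k%:R * dl * X w)).
  exact: L1_cos_shift.
by apply/funext => w; congr cos; ring.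
Qed.

Lemma Ex_dilated_cos dl z k : Ex (fun w => cos (k%:R * (dl * (X w - z)))) =
  cos_transform (k%:R * dl) * cos (k%:R * dl * z) +
  sin_transform (k%:R * dl) * sin (k%:R * dl * z).
Proof.
transitivity (Ex (fun w => cos (- (k%:R * dl * z) + k%:R * dl * X w))).
  by congr (fine (integral _ _ _)); apply/funext => w; congr (cos _)%:E; ring.
by rewrite Ex_cos_shift cosN sinN; ring.
Qed.

(** The expectation of the nth kernel at dl (X - X'), conditionally on
    X' = z. *)
Definition correlation dl n (z : R) : R :=
  Ex (fun w => alternating_dirichlet n (dl * (X w - z))).

Lemma correlationE dl n z : correlation dl n z =
  alternating_sum (fun k => cos_transform (k%:R * dl) * cos (k%:R * dl * z) +
                            sin_transform (k%:R * dl) * sin (k%:R * dl * z)) n.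
Proof.
rewrite /correlation /alternating_dirichlet.
rewrite (@Ex_alternating_sum _ _ _ _ n
  (fun k w => cos (k%:R * (dl * (X w - z))))); last exact: L1_dilated_cos.
by rewrite /alternating_sum; under eq_bigr do rewrite Ex_dilated_cos.
Qed.

Lemma L1_correlation dl n : L1 (fun w => correlation dl n (X w)).
Proof.
rewrite (_ : (fun w => _) = fun w => alternating_sum (fun k =>
  cos_transform (k%:R * dl) * cos (k%:R * dl * X w) +
  sin_transform (k%:R * dl) * sin (k%:R * dl * X w)) n); last first.
  by apply/funext => w; rewrite correlationE.
apply: (@L1_alternating_sum _ _ _ _ n (fun k w =>
  cos_transform (k%:R * dl) * cos (k%:R * dl * X w) +
  sin_transform (k%:R * dl) * sin (k%:R * dl * X w))) => k.
by apply: L1_D; apply: L1_Zl; [exact: L1_cos|exact: L1_sin].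
Qed.

(** Averaging z over the law of X turns cos and sin at z into the transforms
    again, so the coefficients become squares: this is the identity
    E cos(s (X - X')) = |phi(s)|^2. *)
Lemma Ex_correlation dl n : Ex (fun w => correlation dl n (X w)) =
  alternating_sum (fun k => sqnorm_charfun (k%:R * dl)) n.
Proof.
under eq_Rintegral do rewrite correlationE.
rewrite (@Ex_alternating_sum _ _ _ _ n (fun k w =>
  cos_transform (k%:R * dl) * cos (k%:R * dl * X w) +
  sin_transform (k%:R * dl) * sin (k%:R * dl * X w))); last first.
  by move=> k; apply: L1_D; apply: L1_Zl; [exact: L1_cos|exact: L1_sin].
congr (1 + 2 * _); apply: eq_bigr => k _; congr (_ * _).
rewrite RintegralD//; last 2 first.
- by apply: L1_Zl; exact: L1_cos.
- by apply: L1_Zl; exact: L1_sin.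
by rewrite !RintegralZl//; [exact: L1_sin|exact: L1_cos].
Qed.

Lemma L1_dirichlet dl n z :
  L1 (fun w => alternating_dirichlet n (dl * (X w - z))).
Proof.
apply: (@L1_alternating_sum _ _ _ _ n (fun k w =>
  cos (k%:R * (dl * (X w - z))))); exact: L1_dilated_cos.
Qed.

Lemma measurable_fiber x : measurable [set w | X w = x].
Proof.
rewrite -[X in measurable X]setTI.
exact: (mX measurableT (measurable_set1 x)).
Qed.

(** With F(z) the expectation of the Nth translated Fejer kernel at
    dl (X - z): F is nonnegative, the atom y gives F(x) >= N^2 q, and the atom x
    then gives E F(X) >= N^2 q p, while monotonicity forces E F(X) <= N. *)
Lemma sqnorm_charfun_not_decreasing x y :
  point_mass P X x -> point_mass P X y -> x < y ->
  ~ (forall s t, 0 < s -> s <= t -> sqnorm_charfun t <= sqnorm_charfun s).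
Proof.
move=> Px Py xy hdec.
(* This scale maps the gap y - x to the peak of the kernel. *)
pose dl : R := pi / (y - x).
have yx0 : 0 < y - x by rewrite subr_gt0.
have dl0 : 0 < dl by rewrite divr_gt0 ?pi_gt0.
have fineP z : point_mass P X z -> 0 < fine (P [set w | X w = z]).
  move=> Pz; apply: fine_gt0; apply/andP; split; first exact: Pz.
  exact: le_lt_trans (probability_le1 P (measurable_fiber z)) (ltry 1).
have {fineP} [p0 q0] := (fineP _ Px, fineP _ Py).
set p := fine _ in p0; set q := fine _ in q0.
have corrE N z : \sum_(n < N) correlation dl n z =
    Ex (fun w => \sum_(n < N) alternating_dirichlet n (dl * (X w - z))).
  rewrite (@Ex_sum _ _ _ _ N
    (fun n w => alternating_dirichlet n (dl * (X w - z))))// => n.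
  exact: L1_dirichlet.
have L1_fejer N z :
    L1 (fun w => \sum_(n < N) alternating_dirichlet n (dl * (X w - z))).
  apply: (@L1_sum _ _ _ _ N
    (fun n w => alternating_dirichlet n (dl * (X w - z)))) => n.
  exact: L1_dirichlet.
have corr_ge0 N z : 0 <= \sum_(n < N) correlation dl n z.
  by rewrite corrE; apply: Rintegral_ge0 => w _; exact: alternating_fejer_ge0.
have corr_x N : N%:R ^+ 2 * q <= \sum_(n < N) correlation dl n x.
  rewrite corrE; apply: Ex_ge_on_event => //.
  - exact: measurable_fiber.
  - by move=> w; exact: alternating_fejer_ge0.
  - move=> w /= ->; rewrite /dl divfK ?gt_eqF//; exact: alternating_fejer_pi.
have lower N :
    N%:R ^+ 2 * q * p <= \sum_(n < N) Ex (fun w => correlation dl n (X w)).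
  rewrite -(@Ex_sum _ _ _ _ N (fun n w => correlation dl n (X w))); last first.
    by move=> n; exact: L1_correlation.
  apply: Ex_ge_on_event => //.
  - exact: measurable_fiber.
  - by apply: (@L1_sum _ _ _ _ N (fun n w => correlation dl n (X w))) => n;
      exact: L1_correlation.
  - by move=> w /= ->; exact: corr_x.
have upper N : \sum_(n < N) Ex (fun w => correlation dl n (X w)) <= N%:R.
  rewrite -[N in leRHS]card_ord -sumr_const; apply: ler_sum => n _.
  rewrite Ex_correlation; apply: alternating_sum_le1 => k.
    by rewrite addr_ge0// sqr_ge0.
  by apply: hdec; [rewrite mulr_gt0// ltr0n|rewrite ler_pM2r// ler_nat].
pose N := (Num.truncn (q * p)^-1).+1.
have : N%:R * (q * p) <= 1.
  have N0 : 0 < N%:R :> R by rewrite ltr0n.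
  have := le_trans (lower N) (upper N).
  by rewrite -mulrA expr2 -mulrA -{3}[N%:R]mulr1 ler_pM2l.
apply/negP; rewrite -ltNge -ltr_pdivrMr ?mulr_gt0// div1r.
exact: truncnS_gt.
Qed.

Lemma cos_not_reasonable :
  two_point_masses P X -> ~ reasonable P (X : T -> R^o) cos.
Proof.
move=> [x [y [/eqP xy Px Py]]] /reasonable_cos_sqnorm hdec.
have [lt_xy|lt_yx|eq_xy] := ltgtP x y.
- exact: sqnorm_charfun_not_decreasing lt_xy hdec.
- exact: sqnorm_charfun_not_decreasing lt_yx hdec.
- by rewrite eq_xy eqxx in xy.
Qed.

End CharacteristicFunction.

(** * Reduction of vectors to a coordinate *)

Section Coordinates.
Variables (R : realType) (d : measure_display) (T : measurableType d).
Variables (P : probability T R) (n : nat) (X : {RV P >-> borel 'rV[R]_n}).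

Lemma measurable_coord_proj j :
  measurable_fun [set: borel 'rV[R]_n] (coord_proj j : borel 'rV[R]_n -> R).
Proof.
apply: (measurability _ (RGenOpens.measurableE R)) => _ [_ [a [b ->]] <-].
rewrite setTI; apply: sub_sigma_algebra => /=.
apply: open_comp => [x _|]; last exact: interval_open.
exact: coord_continuous.
Qed.

Lemma measurable_coord j :
  measurable_fun [set: T] (fun w => coord_proj j (X w)).
Proof. exact: measurableT_comp (measurable_coord_proj j) _. Qed.

Lemma measurable_vector_fiber (x : 'rV[R]_n) : measurable [set w | X w = x].
Proof.
rewrite (_ : [set _ | _] =
    \bigcap_(j in [set: 'I_n]) [set w | coord_proj j (X w) = coord_proj j x]).
  apply: fin_bigcap_measurable => // j _.
  exact: (measurable_fiber (measurable_coord j)).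
apply/seteqP; split => [w /= Xwx j _ /=|w Xwx]; first by rewrite Xwx.
by apply/rowP => j; exact: (Xwx j).
Qed.

Lemma point_mass_coord j x : point_mass P X x ->
  point_mass P (fun w => coord_proj j (X w)) (coord_proj j x).
Proof.
move=> Px; apply: lt_le_trans Px _; apply: le_measure; rewrite ?inE.
- exact: measurable_vector_fiber.
- exact: (measurable_fiber (measurable_coord j)).
- by move=> w /= ->.
Qed.

(** Every real shift is the jth coordinate of some vector shift, so both suprema
    run over the same set of expectations. *)
Lemma best_payoff_coord (f : R -> R) j s :
  best_payoff P (X : T -> 'rV[R]_n) (fun x => f (coord_proj j x)) s =
  best_payoff P ((fun w => coord_proj j (X w)) : T -> R^o) f s.
Proof.
congr ereal_sup; apply/seteqP; split => _ [a _ <-].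
  exists (coord_proj j a) => //; congr expectation.
  by apply/funext => w; rewrite /coord_proj !mxE.
exists (const_mx a) => //; congr expectation.
by apply/funext => w; rewrite /coord_proj !mxE.
Qed.

Lemma cos_coord_not_reasonable : two_point_masses P X ->
  exists j : 'I_n,
    ~ reasonable P (X : T -> 'rV[R]_n) (fun x => cos (coord_proj j x)).
Proof.
move=> [x [y [xy Px Py]]].
have [j xyj] : exists j, coord_proj j x <> coord_proj j y.
  by apply/existsNP => eq_xy; apply: xy; apply/rowP => j; exact: eq_xy.
exists j => rX; apply: (cos_not_reasonable (measurable_coord j)).
  by exists (coord_proj j x), (coord_proj j y); split => //;
    exact: point_mass_coord.
by move=> s t s0 st; rewrite -!best_payoff_coord; exact: rX.
Qed.

End Coordinates.

Theorem theorem1p11 (R : realType) (d : measure_display)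
    (T : measurableType d) (P : probability T R) :
  (forall X : {RV P >-> R},
     two_point_masses P X -> ~ reasonable P (X : T -> R^o) cos) /\
  (forall (n : nat) (X : {RV P >-> borel 'rV[R]_n}),
     two_point_masses P X ->
     exists j : 'I_n,
       ~ reasonable P (X : T -> 'rV[R]_n) (fun x => cos (coord_proj j x))).
Proof.
split=> [X|n X]; first exact: cos_not_reasonable.
exact: cos_coord_not_reasonable.
Qed.
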